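(* Let $n\ge 1$ and for $i=0,1,\dots,n$ let $$\lambda_i = 1 - \frac{i(2n-i+1)}{n^2},\qquad \pi_i = \frac{\binom{2n}{i}-\binom{2n}{i-1}}{\binom{2n}{n}},$$ with the convention $\binom{2n}{-1}=0$. Let $I$ be a random variable with $P(I=i)=\pi_i$ for $0\le i\le n$, and let $W = n\lambda_I + 1$. Let $Y$ have the exponential distribution with mean $1$, and let $h$ be absolutely continuous with $\|h'\|=\sup_x|h'(x)|<\infty$. Then $$|Eh(W)-Eh(Y)| \le 12\,\|h'\|\, n^{-1/2}.$$
   Context: The numbers $\lambda_i$ with multiplicities $\binom{2n}{i}-\binom{2n}{i-1}$ form the spectrum of the Bernoulli-Laplace Markov chain; $\lambda_I$ is a uniformly chosen eigenvalue counted with multiplicity. *)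

(* Defs.v *)
From HB Require Import structures.
From mathcomp Require Import all_boot all_order all_algebra.
From mathcomp Require Import all_classical all_reals all_analysis.
Set Implicit Arguments. Unset Strict Implicit. Unset Printing Implicit Defensive.
Import Order.TTheory GRing.Theory Num.Theory.
Local Open Scope ring_scope.

(* Absolute continuity of a real function on every compact interval [lo, hi]
   (the usual meaning of "h : R -> R absolutely continuous"): for every
   eps > 0 there is delta > 0 such that for every finite family of pairwise
   non-overlapping subintervals [a k, b k] of [lo, hi] with total length
   < delta, the total variation of h over them is < eps. *)
Definition abs_continuous_fun {R : realType} (h : R -> R) : Prop :=
  forall lo hi : R, forall eps : R, 0 < eps ->
  exists2 delta : R, 0 < delta &
    forall (m : nat) (a b : 'I_m -> R),
      (forall k, lo <= a k /\ a k <= b k /\ b k <= hi) ->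
      (forall k l, k != l -> b k <= a l \/ b l <= a k) ->
      \sum_(k < m) (b k - a k) < delta ->
      \sum_(k < m) `|h (b k) - h (a k)| < eps.

(* The eigenvalues lambda_i of the Bernoulli-Laplace chain. *)
Definition bl_lambda {R : realType} (n i : nat) : R :=
  1 - i%:R * (2 * n%:R - i%:R + 1) / (n%:R ^+ 2).

Definition bl_pi {R : realType} (n i : nat) : R :=
  ('C(2 * n, i)%:R - (if i is j.+1 then 'C(2 * n, j) else 0%N)%:R)
    / 'C(2 * n, n)%:R.

(* Main.v *)
Require Import Defs.
From HB Require Import structures.
From mathcomp Require Import all_boot all_order all_algebra.
From mathcomp Require Import ring lra.
From mathcomp Require Import all_classical all_reals all_analysis.
From mathcomp Require Import measurable_realfun.
Import Order.TTheory GRing.Theory Num.Theory.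
Import numFieldNormedType.Exports.
Local Open Scope ring_scope.

(** An absolutely continuous [h] has a density [d] with respect to Lebesgue
    measure (Radon-Nikodym applied to the two monotone parts of [h] given by its
    total variation), and [h' = d] almost everywhere; hence [h] is
    [M]-Lipschitz.

    Write [i = n - k]. Then [W] takes the value [w_k = k (k + 1) / n] and
    [P(K >= k) = T_k := 'C(2n, n + k) / 'C(2n, n)], with
    [n (T_k - T_(k+1)) = k T_k + (k + 1) T_(k+1)].
    Let [H x = E h(x + Y)], so that [H' = H - h], and put [f = H 0 - H] and
    [g = f' = h - H]. Then [h - E h(Y) = g - f], and summation by parts turns
    [E (g - f)(W)] into the sum over [k >= 1] of [T_k] times the error of the
    trapezoidal rule for [g] on [[w_(k-1), w_k]], an interval of length
    [2 k / n]. As [g] is [2M]-Lipschitz the sum is at most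
    [4 M n^-2 \sum_k k^2 T_k], and the exact moments [\sum_k k T_k = n / 2] and
    [\sum_k k^3 T_k = n^2 / 2] give [\sum_k k^2 T_k <= n^(3/2) / 2]. *)

Set Implicit Arguments.
Unset Strict Implicit.
Unset Printing Implicit Defensive.

(** * Absolutely continuous functions *)

Definition nonoverlapping {R : realType} (p q : R * R) :=
  (p.2 <= q.1) || (q.2 <= p.1).

Definition itv_family {R : realType} (s : seq (R * R)) :=
  all (fun p => p.1 <= p.2) s && pairwise nonoverlapping s.

(** One [delta] serves the whole line. Families are sequences, so that subdividing an interval is a
    concatenation. *)
Definition uniform_abs_continuous {R : realType} (f : R -> R) :=
  forall eps : R, 0 < eps -> exists2 delta : R, 0 < delta &
    forall s, itv_family s -> \sum_(p <- s) (p.2 - p.1) < delta ->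
      \sum_(p <- s) `|f p.2 - f p.1| < eps.

(** For [a <= b], the projection onto [[a, b]]: composing with it turns properties of [h] on
    [[a, b]] into properties on the whole line, where [cumulative] functions live. *)
Definition clamp {R : realType} (a b x : R) := Num.max a (Num.min b x).

Section abs_cont.
Local Open Scope classical_set_scope.
Context {R : realType}.
Implicit Types (f h : R -> R) (s t : seq (R * R)) (a b x y : R).

Lemma clamp_homo a b : {homo clamp a b : x y / x <= y}.
Proof.
by move=> x y xy; rewrite /clamp ge_max le_max lexx/= le_max le_min !ge_min xy lexx !orbT.
Qed.

Lemma clamp_itv a b x : a <= b -> a <= clamp a b x <= b.
Proof. by move=> ab; rewrite /clamp le_max lexx/= ge_max ab ge_min lexx. Qed.

Lemma clamp_id a b x : a <= x <= b -> clamp a b x = x.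
Proof. by move=> /andP[ax xb]; rewrite /clamp (min_idPr xb) (max_idPr ax). Qed.

Lemma clamp_lip a b x y : x <= y -> clamp a b y - clamp a b x <= y - x.
Proof.
move=> xy; rewrite /clamp.
have [?|?] := leP b x; have [?|?] := leP b y.
- by rewrite subrr subr_ge0.
- by lra.
- by have [?|?] := leP a b; have [?|?] := leP a x; lra.
- by have [?|?] := leP a y; have [?|?] := leP a x; lra.
Qed.

(** Clamping is monotone and 1-Lipschitz, so a family is sent into [[a, b]], stays non-overlapping
    and gains no length. *)
Lemma abs_continuous_fun_clamp h a b : a <= b ->
  abs_continuous_fun h -> uniform_abs_continuous (h \o clamp a b).
Proof.
move=> ab hac eps /(hac a b)[d d0 hd]; exists d => // s /andP[sl sn] sd.
have := hd (size s) (fun k => clamp a b (nth (0, 0) s k).1)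
  (fun k => clamp a b (nth (0, 0) s k).2).
rewrite (big_nth (0,0)) big_mkord; apply.
- move=> k; have /andP[-> _] := clamp_itv (nth (0, 0) s k).1 ab.
  have /andP[_ ->] := clamp_itv (nth (0, 0) s k).2 ab.
  split => //; split => //; apply: clamp_homo.
  exact: (allP sl _ (mem_nth _ (ltn_ord k))).
- move=> k l kl; wlog: k l kl / (k < l)%N => [wl|{}kl].
    have [|lk|/val_inj kl'] := ltngtP k l; first exact: wl.
      by have [] := wl l k _ lk; rewrite 1?eq_sym//; [right|left].
    by rewrite kl' eqxx in kl.
  have /(pairwiseP (0, 0))/(_ k l) := sn.
   rewrite !inE !ltn_ord => /(_ isT isT kl)/orP[] ?.
    by left; exact: clamp_homo.
  by right; exact: clamp_homo.
- apply: le_lt_trans sd; rewrite [leRHS](big_nth (0,0)) big_mkord.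
  apply: ler_sum => k _; apply: clamp_lip.
  exact: (allP sl _ (mem_nth _ (ltn_ord k))).
Qed.

Lemma uniform_abs_continuous_continuous f :
  uniform_abs_continuous f -> continuous f.
Proof.
move=> fac x; apply/cvgrPdist_lt => e e0; have [d d0 fd] := fac _ e0.
near=> y.
have xy : `|x - y| < d by near: y; apply: cvgr_dist_lt.
have [le|/ltW le] := leP x y.
  have := fd [:: (x, y)]; rewrite !big_seq1/= /itv_family/= le distrC; apply => //.
  by rewrite -(ger0_norm (_ : 0 <= y - x)) 1?distrC// subr_ge0.
have := fd [:: (y, x)]; rewrite !big_seq1/= /itv_family/= le; apply => //.
by rewrite -(ger0_norm (_ : 0 <= x - y)) // subr_ge0.
Unshelve. all: by end_near. Qed.

(** * Total variation of absolutely continuous functions *)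

Lemma itv_family_path x u : path <%O x u ->
  [/\ itv_family [seq (p.2, p.1) | p <- zip u (x :: u)],
   \sum_(p <- zip u (x :: u)) (p.1 - p.2) = last x u - x &
   all (fun p => (x <= p.2) && (p.1 <= last x u)) (zip u (x :: u))].
Proof.
elim: u x => [x|y u ih x] /=; first by rewrite big_nil subrr.
move=> /andP[xy /[dup] yu /ih[/andP[/= i1 i2] len bd]].
have yl : y <= last y u.
  move: yu => /(sub_path (@ltW _ _)).
  rewrite (path_sortedE le_trans) => /andP[/allP yu _].
  by have := mem_last y u; rewrite inE => /predU1P[->//|/yu].
split.
- rewrite /itv_family/= (ltW xy) i1 i2/= !andbT.
  apply/allP => _ /mapP[p pz ->]; rewrite /nonoverlapping/=.
  by have /andP[->] := allP bd _ pz.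
- by rewrite big_cons/= len; lra.
- rewrite /= lexx yl/=; apply/allP => p /(allP bd)/andP[yp ->].
  by rewrite andbT (le_trans (ltW xy)).
Qed.

(* [t0] collects the intervals that have already been subdivided. *)
Lemma sum_total_variation_acc f (eps : R) s t0 :
  itv_family (t0 ++ s) ->
  (forall t, itv_family t ->
    \sum_(p <- t) (p.2 - p.1) = \sum_(p <- t0 ++ s) (p.2 - p.1) ->
    \sum_(p <- t) `|f p.2 - f p.1| <= eps) ->
  (\sum_(p <- s) total_variation p.1 p.2 f
     <= (eps - \sum_(p <- t0) `|f p.2 - f p.1|)%:E)%E.
Proof.
elim: s t0 => [t0|p s ih t0] fam fle.
  by rewrite cats0 in fam fle; rewrite big_nil lee_fin subr_ge0 fle.
have p12 : p.1 <= p.2.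
  by move: fam => /andP[+ _]; rewrite all_cat/= => /and3P[].
(* The cells of any partition [u] of the first interval can join [t0] without changing the total
   length, so [ih] applies. The supremum over [u] is taken at the end. *)
have key u : itv_partition p.1 p.2 u ->
    (\sum_(p <- s) total_variation p.1 p.2 f
     <= (eps - \sum_(p <- t0) `|f p.2 - f p.1| - variation p.1 p.2 f u)%:E)%E.
  move=> /[dup] pu [/itv_family_path[fu lu bu] /eqP ul].
  rewrite variation_zip//.
  set zu := zip u (p.1 :: u) in fu lu bu *.
  pose t1 := t0 ++ [seq (q.2, q.1) | q <- zu].
  have e1 : \sum_(p <- t1) `|f p.2 - f p.1| =
     \sum_(p <- t0) `|f p.2 - f p.1| + \sum_(x <- zu) `|f x.1 - f x.2|.
    by rewrite big_cat/= big_map.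
  have e2 : \sum_(p <- t1 ++ s) (p.2 - p.1) =
            \sum_(p <- t0 ++ p :: s) (p.2 - p.1).
    by rewrite !big_cat/= big_cons big_map/= lu ul addrA.
  rewrite -addrA -opprD -e1; apply: ih; last by rewrite e2.
  move: fam fu; rewrite /itv_family -catA !all_cat/= !pairwise_cat/=.
  move=> /andP[/and3P[-> _ ->]] /and3P[+ -> /andP[ps ->]] /andP[-> ->].
  rewrite allrel_consr => /andP[t0p t0s]; rewrite /= !andbT.
  rewrite allrel_catr t0s andbT; apply/andP; split.
    apply/allrelP => q _ qt0 /mapP[r rz ->].
    have := allP t0p _ qt0; have := allP bu _ rz.
    rewrite ul /nonoverlapping/= => /andP[r1 r2] /orP[qr|qr].
      by rewrite (le_trans qr).
    by rewrite (le_trans r2) ?orbT.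
  apply/allrelP => _ q /mapP[r rz ->] qs.
  have := allP ps _ qs; have := allP bu _ rz.
  rewrite ul /nonoverlapping/= => /andP[r1 r2] /orP[qr|qr].
    by rewrite (le_trans r2).
  by rewrite (le_trans qr) ?orbT.
rewrite big_cons; set S := (\sum_(_ <- s) _)%E in key *.
have S0 : (0 <= S)%E.
  rewrite /S big_seq; apply: sume_ge0 => q qs; apply: total_variation_ge0.
  move: fam => /andP[+ _]; rewrite all_cat/= => /and3P[_ _ /allP]; exact.
move: p12; rewrite le_eqVlt => /predU1P[p12|p12].
  rewrite p12 total_variationxx add0e.
  have /key/le_trans : itv_partition p.1 p.2 [::].
    by rewrite /itv_partition/= p12.
  by apply; rewrite lee_fin lerBlDr lerDl variation_ge0.
(* Finiteness, seen on the trivial partition, allows [S] to cross the inequality before the supremum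
   is taken. *)
have Sfin : S \is a fin_num.
  have := key [:: p.2]; rewrite ge0_fin_numE// => /(_ (itv_partition1 p12)).
  by move=> /le_lt_trans; apply; rewrite ltry.
rewrite -leeBrDr//; apply: ge_ereal_sup => _ [_ [u pu <-] <-].
by rewrite leeBrDr// addeC -leeBrDr// -EFinB key.
Qed.

Lemma sum_total_variation_le f (eps : R) s : itv_family s ->
  (forall t, itv_family t ->
    \sum_(p <- t) (p.2 - p.1) = \sum_(p <- s) (p.2 - p.1) ->
    \sum_(p <- t) `|f p.2 - f p.1| <= eps) ->
  (\sum_(p <- s) total_variation p.1 p.2 f <= eps%:E)%E.
Proof.
move=> fam fle; have := @sum_total_variation_acc f eps s [::] fam fle.
by rewrite big_nil subr0.
Qed.

(** Subdivision preserves the total length, so the same [delta] works for the variations. *)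
Lemma uniform_abs_continuous_TV f (eps : R) : uniform_abs_continuous f ->
  0 < eps -> exists2 delta : R, 0 < delta &
    forall s, itv_family s -> \sum_(p <- s) (p.2 - p.1) < delta ->
      (\sum_(p <- s) total_variation p.1 p.2 f <= eps%:E)%E.
Proof.
move=> fac e0; have [d d0 fd] := fac _ e0; exists d => // s sf sd.
by apply: sum_total_variation_le => // t tf tl; rewrite ltW// fd// tl.
Qed.

(** Cut [[a, b]] into [N] cells shorter than the [delta] given for [1]: each adds at most [1] to the
    total variation. *)
Lemma uniform_abs_continuous_BV f a b : a <= b ->
  uniform_abs_continuous f -> bounded_variation a b f.
Proof.
move=> ab fac; apply/bounded_variationP => //.
have [d d0 fd] := uniform_abs_continuous_TV fac ltr01.
rewrite ge0_fin_numE ?total_variation_ge0//.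
pose N := (Num.truncn ((b - a) / d)).+1.
have NN : (b - a) / N%:R < d.
  rewrite ltr_pdivrMr ?ltr0n// mulrC -ltr_pdivrMr// /N.
  by rewrite truncnS_gt.
pose c k := a + k%:R * ((b - a) / N%:R).
have c_le k : c k <= c k.+1.
  by rewrite /c lerD2l ler_wpM2r ?ler_nat// divr_ge0// subr_ge0.
have ca k : a <= c k by rewrite /c lerDl mulr_ge0// divr_ge0// subr_ge0.
have cN : c N = b by rewrite /c mulrCA divff ?pnatr_eq0// mulr1; lra.
suff: forall k, (total_variation a (c k) f <= k%:R%:E)%E.
  by move=> /(_ N); rewrite cN => /le_lt_trans; apply; rewrite ltry.
elim=> [|k ih]; first by rewrite /c mul0r addr0 total_variationxx.
rewrite (total_variationD f (ca k) (c_le k)) -natr1 EFinD leeD//.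
have := fd [:: (c k, c k.+1)]; rewrite !big_seq1/=; apply.
  by rewrite /itv_family/= c_le.
rewrite /c -natr1; move: NN; lra.
Qed.

(** The variation function of [h] on [[a, b]], extended by constants when [a <= b]; it is the first
    monotone part in the Jordan decomposition. *)
Definition clamped_variation (a b : R) h x :=
  fine (total_variation a (clamp a b x) (h \o clamp a b)).

Section clamped.
Variables (a b : R) (h : R -> R).
Hypotheses (ab : a <= b) (hac : uniform_abs_continuous (h \o clamp a b)).
Local Notation k := (h \o clamp a b).
Local Notation v := (clamped_variation a b h).

Let tv_fin x : total_variation a (clamp a b x) k \is a fin_num.
Proof.
have /andP[ax xb] := clamp_itv x ab.
by apply/bounded_variationP => //; exact: uniform_abs_continuous_BV.
Qed.

Lemma clamped_variationB x y : x <= y ->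
  (v y - v x)%:E = total_variation (clamp a b x) (clamp a b y) k.
Proof.
move=> xy; rewrite EFinB /v !fineK//.
have /andP[ax _] := clamp_itv x ab.
rewrite (total_variationD _ ax (clamp_homo a b xy)) addeAC subee ?add0e//.
Qed.

Lemma clamped_variation_ge x y : x <= y -> `|k y - k x| <= v y - v x.
Proof.
move=> xy; rewrite -lee_fin clamped_variationB//.
have := total_variation_ge k (clamp_homo a b xy).
by rewrite /= !(clamp_id (clamp_itv _ ab)).
Qed.

Lemma clamped_variation_homo : {homo v : x y / x <= y}.
Proof.
by move=> x y xy; rewrite -subr_ge0 (le_trans _ (clamped_variation_ge xy)).
Qed.

Lemma itv_family_clamp s : itv_family s ->
  itv_family [seq (clamp a b p.1, clamp a b p.2) | p <- s].
Proof.
move=> /andP[sl sn]; apply/andP; split.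
  by rewrite all_map; apply: sub_all sl => p /= /clamp_homo.
rewrite pairwise_map; apply: sub_pairwise sn => p q /=.
by rewrite /nonoverlapping/= => /orP[] /(clamp_homo a b) ->; rewrite ?orbT.
Qed.

Lemma uniform_abs_continuous_clamped_variation : uniform_abs_continuous v.
Proof.
move=> e e0; have e20 : 0 < e / 2 by rewrite divr_gt0.
have [d d0 vd] := uniform_abs_continuous_TV hac e20.
exists d => // s sf sd; have /andP[/allP sl _] := sf.
rewrite (@le_lt_trans _ _ (e / 2))//; last by lra.
rewrite -lee_fin; have := vd _ (itv_family_clamp sf).
rewrite !big_map/= => vds.
rewrite -sumEFin big_seq.
under eq_bigr => p ps.
  rewrite ger0_norm ?subr_ge0 ?clamped_variation_homo ?sl//.
  rewrite clamped_variationB ?sl//.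
  over.
rewrite -big_seq; apply: vds; apply: le_lt_trans sd.
rewrite !big_seq; apply: ler_sum => p ps; apply: clamp_lip; exact: sl.
Qed.

End clamped.

Lemma uniform_abs_continuous_le f g (c : R) : 0 < c ->
  (forall x y, x <= y -> `|g y - g x| <= c * `|f y - f x|) ->
  uniform_abs_continuous f -> uniform_abs_continuous g.
Proof.
move=> c0 gf fac e e0; have [|d d0 fd] := fac (e / c); first by rewrite divr_gt0.
exists d => // s sf sd; have /andP[/allP sl _] := sf.
rewrite (@le_lt_trans _ _ (c * \sum_(p <- s) `|f p.2 - f p.1|))//.
  by rewrite mulr_sumr !big_seq; apply: ler_sum => p ps; apply: gf; exact: sl.
by rewrite mulrC -ltr_pdivlMr// fd.
Qed.

(** * Lebesgue-Stieltjes measures and densities *)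

Lemma lebesgue_stieltjes_itvoc (F : cumulative R R) x y : x <= y ->
  lebesgue_stieltjes_measure F `]x, y]%classic = (F y - F x)%:E.
Proof.
move=> xy; rewrite /lebesgue_stieltjes_measure/= /measure_extension.
rewrite measurable_mu_extE/=; last exact: is_ocitv.
by rewrite wlength_itv_bnd.
Qed.

(** Finite measure excludes an unbounded hull, and a bounded open interval is the interior of its
    hull. *)
Lemma bounded_open_itv (I : set R) (d : R) :
  open I -> is_interval I -> I !=set0 -> (lebesgue_measure I < d%:E)%E ->
  inf I < sup I /\ I = `]inf I, sup I[%classic.
Proof.
move=> oI iI [z Iz] ltd.
have [lI uI] : has_lbound I /\ has_ubound I.
  have IE : I = [set` Rhull I] by rewrite RhullK ?inE.
  have : z \in Rhull I by move: Iz; rewrite {1}IE.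
  move: ltd; rewrite {1}IE lebesgue_measure_itv.
  case: (Rhull I) IE => -[bl l|[|]] [br r|[|]] IE//=;
    rewrite ?ltNyr ?ltry ?ltNye//= => _; rewrite in_itv/= ?andbF// => _.
  split; [exists l|exists r] => x; rewrite IE/= in_itv/= => /andP[].
    by move=> /lteifW.
  by move=> _ /lteifW.
have E : I = `]inf I, sup I[%classic.
  by rewrite -[LHS](interior_id I).1// interval_bounded_interior//.
split=> //; move: Iz; rewrite {1}E/= in_itv/= => /andP[]; exact: lt_trans.
Qed.

(** Outer regularity puts a null set into an open [U] of measure below [delta]. Finitely many
    components of [U] form an interval family, over which the increments of [F] sum to less than
    [e]; let their number grow. *)
Lemma uniform_abs_continuous_dominates (F : cumulative R R) :
  uniform_abs_continuous F ->
  lebesgue_stieltjes_measure F `<< @lebesgue_measure R.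
Proof.
move=> Fac; apply/null_content_dominatesP => A mA A0.
apply/eqP; rewrite eq_le measure_ge0 andbT; apply/lee_addgt0Pr => e e0.
rewrite add0e; have [d d0 Fd] := Fac _ e0.
have [|U [oU AU UAd]] := lebesgue_regularity_outer mA _ d0; first by rewrite A0 ltry.
have mU : measurable U by exact: open_measurable.
have Ud : (lebesgue_measure U < d%:E)%E.
  apply: le_lt_trans UAd; rewrite -{1}(setDUK AU).
  rewrite (le_trans (measureU2 _ _ _))//; first exact: measurableD.
  by rewrite A0 add0e.
apply: (@le_trans _ _ (lebesgue_stieltjes_measure F U)).
  by apply: le_measure; rewrite ?inE.
pose I := open_disjoint_itv oU.
have oI i : open (I i) by exact: open_disjoint_itv_open.
have iI i : is_interval (I i) by exact: open_disjoint_itv_is_interval.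
have tI : trivIset setT I by exact: open_disjoint_itv_trivIset.
have mI i : measurable (I i) by exact: open_measurable.
have UI : U = \bigcup_i I i by exact: open_disjoint_itv_bigcup.
have Id i : (lebesgue_measure (I i) < d%:E)%E.
  apply: le_lt_trans Ud; apply: le_measure; rewrite ?inE.
  - exact: mI.
  - exact: mU.
  - by rewrite UI; exact: bigcup_sup.
rewrite UI measure_semi_bigcup -?UI//.
apply: lime_le; first by apply: is_cvg_nneseries => *; exact: measure_ge0.
apply: nearW => N.
(* The enumeration may contain empty components, whose [inf] and [sup] are not endpoints. *)
pose J := [seq i <- iota 0 N | I i != set0].
have IE i : i \in J -> inf (I i) < sup (I i) /\ I i = `]inf (I i), sup (I i)[%classic.
  rewrite mem_filter => /andP[/set0P I0 _]; exact: bounded_open_itv (Id i).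
pose s := [seq (inf (I i), sup (I i)) | i <- J].
have sJ (m : {measure set (measurableTypeR R) -> \bar R}) :
    (\sum_(0 <= i < N) m (I i) = \sum_(i <- J) m (I i))%E.
  rewrite big_filter /index_iota subn0 [LHS](bigID (fun i => I i != set0))/=.
  by rewrite [X in (_ + X)%E]big1 ?adde0// => i /negPn/eqP ->; rewrite measure0.
have sf : itv_family s.
  apply/andP; split.
    by rewrite all_map; apply/allP => i /IE[/ltW].
  rewrite pairwise_map.
  have uJ : uniq J by rewrite filter_uniq// iota_uniq.
  apply/(pairwiseP 0%N) => i j; rewrite !inE => iJ jJ ij.
  have [iI' iE] := IE _ (mem_nth 0%N iJ); have [jI' jE] := IE _ (mem_nth 0%N jJ).
  rewrite /= /nonoverlapping/= leNgt [X in _ || X]leNgt -negb_and; apply/negP.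
  set x := nth 0%N J i in iI' iE *; set y := nth 0%N J j in jI' jE *.
  move=> /andP[yx xy].
  suff : I x `&` I y !=set0.
    move=> /(tI _ _ Logic.I Logic.I)/eqP; rewrite /x /y nth_uniq// => /eqP ijE.
    by rewrite ijE ltnn in ij.
  (* Overlapping components would share the midpoint of their intersection, against disjointness. *)
  exists ((Num.max (inf (I x)) (inf (I y)) + Num.min (sup (I x)) (sup (I y))) / 2).
  have mM : Num.max (inf (I x)) (inf (I y)) < Num.min (sup (I x)) (sup (I y)).
    by rewrite gt_max !lt_min iI' jI' yx xy.
  have mx1 : inf (I x) <= Num.max (inf (I x)) (inf (I y)) by rewrite le_max lexx.
  have mx2 : inf (I y) <= Num.max (inf (I x)) (inf (I y)) by rewrite le_max lexx orbT.
  have mn1 : Num.min (sup (I x)) (sup (I y)) <= sup (I x) by rewrite ge_min lexx.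
  have mn2 : Num.min (sup (I x)) (sup (I y)) <= sup (I y) by rewrite ge_min lexx orbT.
  have IxP z : inf (I x) < z < sup (I x) -> I x z by rewrite {3}iE/= in_itv.
  have IyP z : inf (I y) < z < sup (I y) -> I y z by rewrite {3}jE/= in_itv.
  by split; [apply: IxP|apply: IyP]; apply/andP; split; lra.
have sd : \sum_(p <- s) (p.2 - p.1) < d.
  rewrite -lte_fin; apply: le_lt_trans Ud.
  rewrite big_map/= -sumEFin.
  apply: (@le_trans _ _ (\sum_(0 <= i < N) lebesgue_measure (I i))%E).
    rewrite sJ !big_seq; apply: lee_sum => i /IE[lt iE].
    by rewrite {3}iE [leRHS]lebesgue_measure_itv/= lte_fin lt -EFinB.
  rewrite UI measure_semi_bigcup -?UI//.
  by apply: nneseries_lim_ge => *; exact: measure_ge0.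
apply: (@le_trans _ _ (\sum_(p <- s) `|F p.2 - F p.1|)%:E); last first.
  by rewrite lee_fin ltW// Fd.
rewrite sJ big_map/= -sumEFin !big_seq; apply: lee_sum => i /IE[lt iE].
apply: (@le_trans _ _ (lebesgue_stieltjes_measure F `]inf (I i), sup (I i)]%classic)).
  apply: le_measure; rewrite ?inE//.
    by rewrite iE; exact: measurable_itv.
  by rewrite {1}iE => z /=; rewrite !in_itv/= => /andP[-> /ltW].
by rewrite lebesgue_stieltjes_itvoc ?(ltW lt)// lee_fin ler_norm.
Qed.

(** Radon-Nikodym for the Stieltjes measure of [F] restricted to []a, b]], where it is finite. *)
Lemma abs_continuous_density (F : cumulative R R) a b : a <= b ->
  uniform_abs_continuous F ->
  exists2 g : R -> R, (@lebesgue_measure R).-integrable setT (EFin \o g) &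
    forall x, a <= x <= b ->
      F x - F a = (\int[@lebesgue_measure R]_(t in `]a, x]) g t)%R.
Proof.
move=> ab /uniform_abs_continuous_dominates Fdom.
pose mab : measurable (`]a, b]%classic : set (measurableTypeR R)) :=
  measurable_itv _.
have Fab : (lebesgue_stieltjes_measure F `]a, b]%classic < +oo)%E.
  by rewrite lebesgue_stieltjes_itvoc// ltry.
pose nu : {finite_measure set (measurableTypeR R) -> \bar R} := mfrestr mab Fab.
have nudom : nu `<< @lebesgue_measure R.
  apply/null_content_dominatesP => A mA A0.
  move/null_content_dominatesP : Fdom; apply; first exact: measurableI.
  apply/eqP; rewrite eq_le measure_ge0 andbT -A0.
  by apply: le_measure; rewrite ?inE//; exact: measurableI.
have [g [g0 gfin gint gE]] := radon_nikodym_sigma_finite nudom.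
have gf : EFin \o (fine \o g) = g by apply/funext => x /=; rewrite fineK.
exists (fine \o g); first by rewrite gf.
move=> x /andP[ax xb]; rewrite /Rintegral.
under eq_integral do rewrite /= fineK//.
rewrite -gE; last exact: measurable_itv.
rewrite /nu/= /mfrestr /mrestr setIidl; last first.
  by move=> z /=; rewrite !in_itv/= => /andP[-> /le_trans ->].
by rewrite lebesgue_stieltjes_itvoc.
Qed.

(** On [[a, b]], [h = v - u] with [v] the variation function. Increments of [u] lie between [0] and
    twice those of [v], so both parts are monotone and absolutely continuous, and their densities
    subtract. *)
Lemma abs_continuous_fun_density h a b : a <= b ->
  abs_continuous_fun h ->
  exists2 g : R -> R, (@lebesgue_measure R).-integrable setT (EFin \o g) &
    forall x, a <= x <= b ->
      h x - h a = (\int[@lebesgue_measure R]_(t in `]a, x]) g t)%R.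
Proof.
move=> ab /(abs_continuous_fun_clamp ab) hac.
pose v := clamped_variation a b h; pose u x := v x - h (clamp a b x).
have vac : uniform_abs_continuous v.
  exact: uniform_abs_continuous_clamped_variation.
have vnd : {homo v : x y / x <= y} by exact: clamped_variation_homo.
have uv x y : x <= y -> 0 <= u y - u x <= 2 * (v y - v x).
  move=> xy; have := clamped_variation_ge ab hac xy.
  rewrite -/v ler_norml /u/=; lra.
have uac : uniform_abs_continuous u.
  apply: (@uniform_abs_continuous_le v u 2) => // x y xy.
  have /andP[u0 u1] := uv _ _ xy.
  by rewrite !ger0_norm// subr_ge0 vnd.
have und : {homo u : x y / x <= y}.
  by move=> x y /uv/andP[]; rewrite subr_ge0.
have vrc : right_continuous v.
  exact/right_continuousW/uniform_abs_continuous_continuous.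
have urc : right_continuous u.
  exact/right_continuousW/uniform_abs_continuous_continuous.
pose V : cumulative R R := HB.pack v (isCumulative.Build R _ R v vnd vrc).
pose W : cumulative R R := HB.pack u (isCumulative.Build R _ R u und urc).
have [gv gvi gvE] := @abs_continuous_density V a b ab vac.
have [gu gui guE] := @abs_continuous_density W a b ab uac.
exists (gv \- gu).
  rewrite (_ : EFin \o _ = (EFin \o gv) \- (EFin \o gu))%E//.
  exact: integrableB.
move=> x xab; rewrite RintegralB//.
- rewrite -gvE// -guE// /V /W/= /u !clamp_id ?lexx//; lra.
- exact: integrableS gvi.
- exact: integrableS gui.
Qed.

(** By Lebesgue differentiation, at almost every point of []a, b[] the function [h] is
    differentiable with derivative the density [g]. There [M] bounds [g], and integrating gives the
    claim. *)
Lemma abs_continuous_fun_lipschitz h (M : R) : abs_continuous_fun h -> 0 <= M ->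
  (forall x, derivable h x 1 -> `|(h^`())%classic x| <= M) ->
  forall a b, a <= b -> `|h b - h a| <= M * (b - a).
Proof.
move=> hac M0 hM a b; rewrite le_eqVlt => /predU1P[->|ab].
  by rewrite !subrr normr0 mulr0.
have [g gint gE] := abs_continuous_fun_density (ltW ab) hac.
have abR : a <= b <= b by rewrite (ltW ab) lexx.
pose mu := @lebesgue_measure R.
have gi D : measurable D -> mu.-integrable D (EFin \o g).
  by move=> mD; exact: integrableS gint.
have gM : {ae mu, forall x, `]a, b[%classic x -> (`|g x|%:E <= M%:E)%E}.
  have lg : locally_integrable setT g.
    by apply: open_integrable_locally => //; exact: openT.
  have := @FTC1 R g (BRight a) (fun y => gi _ (measurable_itv _)) lg.
  apply: filterS; first exact: (ae_filter_ringOfSetsType mu).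
  move=> x /= + /[!in_itv]/= /andP[ax xb].
  move=> /(_ ax)[dF F'].
  pose G y := \int[mu]_(t in `]a, y]) g t.
  have near_h : \forall y \near x, G y + h a = h y.
    near=> y; rewrite /G -gE ?subrK//; apply/andP; split; apply: ltW; near: y.
      exact: lt_nbhsr.
    exact: lt_nbhsl.
  have dG : is_derive x 1 G (g x).
    by apply: DeriveDef => //; rewrite -derive1E.
  have dh : is_derive x 1 h (g x).
    apply: near_eq_is_derive near_h _.
    by rewrite -[g x]addr0; exact: is_deriveD.
  rewrite lee_fin; have [dxh <-] := dh.
  by rewrite -derive1E; exact: hM.
have mab : measurable (`]a, b[%classic : set (measurableTypeR R)).
  exact: measurable_itv.
rewrite gE// -Rintegral_itv_bndo_bndc; last exact: gi.
apply: le_trans (le_normr_Rintegral mab (gi _ mab)) _.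
rewrite -lee_fin /Rintegral fineK; last first.
  by apply: integrable_fin_num => //; exact/integrable_norm/gi.
apply: le_trans (_ : _ <= \int[mu]_(x in `]a, b[) M%:E)%E _.
  apply: ae_ge0_le_integral => //.
  by apply: measurable_int; exact/integrable_norm/gi.
by rewrite integral_cst//= /mu lebesgue_measure_itv/= lte_fin ab -EFinB -EFinM.
Unshelve. all: by end_near. Qed.

(* A negative bound would make [h] constant, hence differentiable everywhere. *)
Lemma abs_continuous_fun_bound_ge0 h (M : R) : abs_continuous_fun h ->
  (forall x, derivable h x 1 -> `|(h^`())%classic x| <= M) -> 0 <= M.
Proof.
move=> hac hM; rewrite leNgt; apply/negP => M0.
have lip : forall a b, a <= b -> `|h b - h a| <= 0 * (b - a).
  apply: abs_continuous_fun_lipschitz => // x /hM /le_trans; apply; exact: ltW.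
have hE : h = cst (h 0).
  apply/funext => x /=.
  have [/lip|/ltW/lip] := leP 0 x; rewrite mul0r normr_le0 subr_eq0 => /eqP//.
have : derivable h 0 1 by rewrite hE.
by move=> /hM; rewrite leNgt (lt_le_trans M0).
Qed.

End abs_cont.

(** * The Stein equation of the exponential law *)

Section exponential_integral.
Local Open Scope classical_set_scope.
Context {R : realType}.
Local Notation mu := (@lebesgue_measure R).

Let P : {finite_measure set (measurableTypeR R) -> \bar R} :=
  exponential_distribution_exponential_prob__canonical__measure_function_FiniteMeasure
    (@ltr01 R).

Let mpdf : measurable_fun [set: R]
  (EFin \o exponential_pdf (1 : R)).
Proof. by apply/measurable_EFinP; exact: measurable_exponential_pdf. Qed.

Let exponential_prob_dominates : P `<< mu.
Proof.
apply/null_content_dominatesP => A mA A0.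
apply: null_set_integral => //; exact: measurable_funTS.
Qed.

(** The Radon-Nikodym derivative and the density have equal integrals over every measurable set,
    hence agree almost everywhere. *)
Lemma ge0_integral_exponential_prob (f : R -> \bar R) : (forall x, 0 <= f x)%E ->
  measurable_fun [set: R] f ->
  (\int[exponential_prob (1 : R)]_x f x =
   \int[mu]_x (f x * (exponential_pdf 1 x)%:E))%E.
Proof.
move=> f0 mf.
have <- := Radon_Nikodym_SigmaFinite.change_of_variables exponential_prob_dominates
  f0 measurableT mf.
have iRN := Radon_Nikodym_SigmaFinite.f_integrable exponential_prob_dominates.
have mRN := measurable_int _ iRN.
apply: ae_eq_integral => //.
- exact: emeasurable_funM.
- exact: emeasurable_funM.
- apply: ae_eqe_mul2l; apply: integral_ae_eq => // A _ mA.
  by rewrite -Radon_Nikodym_SigmaFinite.f_integral.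
Qed.

Lemma integral_exponential_prob (h : R -> R) :
  measurable_fun [set: R] h ->
  (\int[exponential_prob (1 : R)]_x (h x)%:E =
   \int[mu]_(x in `[0%R, +oo[) (h x * expR (- x))%:E)%E.
Proof.
move=> mh.
have mEh : measurable_fun [set: R] (EFin \o h).
  exact/measurable_EFinP.
transitivity (\int[mu]_x (h x * exponential_pdf 1 x)%:E)%E.
  rewrite integralE [RHS]integralE !ge0_integral_exponential_prob//.
  - congr (_ - _)%E; apply: eq_integral => x _; rewrite !(funeposE, funenegE)/=.
      rewrite -!EFin_max -EFinM maxr_pMl ?exponential_pdf_ge0//.
      by rewrite mul0r.
    rewrite -!EFin_max -EFinM maxr_pMl ?exponential_pdf_ge0//.
    by rewrite mul0r mulNr.
  - exact: measurable_funeneg.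
  - exact: measurable_funepos.
rewrite [RHS]integral_mkcond; apply: eq_integral => x _.
rewrite /exponential_pdf !patchE; case: ifPn => _; rewrite ?mulr0//.
by rewrite mul1r mulN1r.
Qed.

(** Split [exp(-x)] into two factors [exp(-x/2)]: one absorbs the linear term, as [x <= 2 exp(x/2)],
    the other tends to [0]. *)
Lemma cvg_linear_expRN (c : R) : (x - c) * expR (- x) @[x --> +oo] --> (0 : R).
Proof.
have e2 : expR (- (x / 2)) @[x --> +oo] --> (0 : R).
  apply: (@cvg_comp _ _ _ (fun x : R => x / 2) (fun x => expR (- x)) _ (pinfty_nbhs R)).
    exact: gt0_cvgMly.
  exact: cvgr_expR.
apply/norm_cvg0P.
apply: (@squeeze_cvgr _ _ _ _ (cst 0) (fun x => (2 + `|c|) * expR (- (x / 2)))).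
- near=> x; rewrite normr_ge0/=.
  have x0 : 0 <= x by near: x; exact: nbhs_pinfty_ge.
  have -> : expR (- x) = expR (- (x / 2)) * expR (- (x / 2)).
    by rewrite -expRD; congr expR; lra.
  rewrite mulrA normrM (ger0_norm (expR_ge0 _)) ler_wpM2r ?expR_ge0//.
  rewrite normrM (ger0_norm (expR_ge0 _)).
  rewrite (le_trans (ler_wpM2r _ (ler_normB _ _))) ?expR_ge0//.
  rewrite mulrDl lerD//.
    rewrite ger0_norm// expRN ler_pdivrMr ?expR_gt0//.
    have := expR_ge1Dx (x / 2); lra.
  by rewrite ler_piMr// expR_le1; lra.
- exact: cvg_cst.
- by rewrite -[X in _ --> X](mulr0 (2 + `|c|)); apply: cvgMr.
Unshelve. all: by end_near. Qed.

Let lin_exp_derive (c x : R) :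
  is_derive x 1 (fun t => - ((t - c + 1) * expR (- t))) ((x - c) * expR (- x)).
Proof.
by apply: is_derive_eq; rewrite /GRing.scale/=; ring.
Qed.

Let lin_exp_cont (c : R) : continuous (fun t : R => (t - c) * expR (- t)).
Proof.
move=> x; apply: differentiable_continuous.
apply/derivable1_diffP; exact: ex_derive.
Qed.

(** The antiderivative is [-(t - c + 1) exp(-t)]. Later [c = x] gives the first moment, [c = x - 1]
    minus [c = x] gives [exp(-t)], and [c = -2] a dominating function. *)
Lemma integral_linear_expRN (c x : R) : c <= x ->
  (\int[mu]_(t in `[x, +oo[) ((t - c) * expR (- t))%:E =
   ((x - c + 1) * expR (- x))%:E)%E.
Proof.
move=> cx.
rewrite (@ge0_continuous_FTC2y _ _ (fun t => - ((t - c + 1) * expR (- t))) _ 0).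
- by rewrite -EFinB sub0r opprK.
- by move=> t xt; rewrite mulr_ge0 ?expR_ge0// subr_ge0 (le_trans cx).
- by apply: continuous_subspaceT; exact: lin_exp_cont.
- rewrite -oppr0; apply: cvgN.
  have -> : (fun t : R => (t - c + 1) * expR (- t)) =
            (fun t => (t - (c - 1)) * expR (- t)).
    by apply/funext => t; congr (_ * _); ring.
  exact: cvg_linear_expRN.
- by move=> t _; exact: ex_derive.
- apply: cvg_at_right_filter.
  have /derivable1_diffP/differentiable_continuous :
    derivable (fun t => - ((t - c + 1) * expR (- t))) x 1 by exact: ex_derive.
  exact.
- by move=> t _; rewrite derive1E; have [_ ->] := lin_exp_derive c t.
Qed.

Lemma integrable_linear_expRN (c x : R) : c <= x ->
  mu.-integrable `[x, +oo[ (fun t => ((t - c) * expR (- t))%:E).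
Proof.
move=> cx; apply/integrableP; split.
  apply/measurable_EFinP/measurable_funTS; apply: continuous_measurable_fun.
  exact: lin_exp_cont.
under eq_integral => t.
  rewrite inE/= in_itv/= andbT => xt.
  rewrite /= ger0_norm ?mulr_ge0 ?expR_ge0 ?subr_ge0 ?(le_trans cx)//.
  over.
by rewrite integral_linear_expRN// ltry.
Qed.

Lemma Rintegral_linear_expRN (c x : R) : c <= x ->
  (\int[mu]_(t in `]x, +oo[) ((t - c) * expR (- t)) =
   (x - c + 1) * expR (- x))%R.
Proof.
move=> cx; rewrite Rintegral_itv_obnd_cbnd.
  by rewrite /Rintegral integral_linear_expRN.
apply: integrableS (integrable_linear_expRN cx) => //.
by move=> t /=; rewrite !in_itv/= !andbT => /ltW.
Qed.

End exponential_integral.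

(** * The function [E h(x + Y)] and its derivative *)

Section stein_equation.
Local Open Scope classical_set_scope.
Context {R : realType}.
Local Notation mu := (@lebesgue_measure R).
Variables (h : R -> R) (M : R).
Hypothesis M0 : 0 <= M.
Implicit Types x y t u v a b : R.
Hypothesis h_lip : forall a b : R, a <= b -> `|h b - h a| <= M * (b - a).

Let h_cont : continuous h.
Proof.
move=> x; apply/cvgrPdist_lt => e e0.
(* [M] may be zero, so [M + 1] is the divisor. *)
have M1 : 0 < M + 1 by rewrite ltr_wpDl.
near=> y.
have xy : `|x - y| < e / (M + 1) by near: y; apply: cvgr_dist_lt => //; rewrite divr_gt0.
suff hxy : `|h x - h y| <= M * `|x - y|.
  rewrite ltr_pdivlMr// in xy; have := normr_ge0 (x - y); lra.
have [xy'|/ltW xy'] := leP x y.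
  by rewrite distrC (distrC x) (ger0_norm (_ : 0 <= y - x)) ?subr_ge0// h_lip.
by rewrite (ger0_norm (_ : 0 <= x - y)) ?subr_ge0// h_lip.
Unshelve. all: by end_near. Qed.

Let mh : measurable_fun [set: R] h.
Proof. exact: continuous_measurable_fun. Qed.

Let phi t := h t * expR (- t).

Let phi_cont : continuous phi.
Proof.
move=> x; apply: cvgM; first exact: h_cont.
apply: continuous_comp; last exact: continuous_expR.
by apply: cvgN.
Qed.

(** Starting at [-1] makes [0] an interior point, so [stein_mean] is differentiable there. The
    Lipschitz bound from [-1] gives [|h t| <= C (t + 2)]. *)
Let integrable_phi : mu.-integrable `[-1, +oo[ (EFin \o phi).
Proof.
pose C := `|h (-1)| + M.
have iC : mu.-integrable `[-1, +oo[ (fun t => C%:E * ((t - (- 2)) * expR (- t))%:E)%E.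
  by apply: integrableZl => //; apply: integrable_linear_expRN; lra.
apply: le_integrable iC => //.
  apply/measurable_EFinP/measurable_funTS; apply: continuous_measurable_fun.
  exact: phi_cont.
move=> t /=; rewrite in_itv/= andbT => t1.
rewrite lee_fin /phi normrM mulrA [leRHS]normrM.
rewrite ler_wpM2r//.
have C0 : 0 <= C by rewrite addr_ge0.
rewrite [leRHS]ger0_norm; last by rewrite mulr_ge0//; lra.
have h1 := h_lip t1; have h2 := ler_normD (h t - h (-1)) (h (-1)).
rewrite subrK in h2; have := normr_ge0 (h (-1)); have := M0; rewrite /C; nra.
Qed.

Let integrable_phi_itv x : -1 <= x -> mu.-integrable `]x, +oo[ (EFin \o phi).
Proof.
move=> x1; apply: integrableS integrable_phi => //.
by move=> t /=; rewrite !in_itv/= !andbT => /ltW; exact: le_trans.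
Qed.

(* [stein_mean x] is [E h (x + Y)] for [Y] exponential of mean 1. *)
Definition stein_mean x :=
  expR x * (\int[mu]_(t in `]x, +oo[) (h t * expR (- t)))%R.

(** Near [x] the tail integral is a constant minus [F], so its derivative is [- phi x]; conclude by
    the product rule. *)
Lemma is_derive_stein_mean x : -1 < x ->
  is_derive x 1 stein_mean (stein_mean x - h x).
Proof.
move=> x1.
pose F y := \int[mu]_(t in `[-1, y]) phi t.
pose T y := \int[mu]_(t in `]y, +oo[) phi t.
have dF : is_derive x 1 F (phi x).
  have [|||dF F'] := @continuous_FTC1 R phi (BLeft (-1)) x (x + 1) _ _ _ (@phi_cont x).
  - by rewrite ltrDl.
  - apply: integrableS integrable_phi => //.
    by move=> t /=; rewrite !in_itv/= andbT => /andP[].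
  - by [].
  - by apply: DeriveDef => //; rewrite -derive1E.
have nT : \forall y \near x, \int[mu]_(t in `[-1, +oo[) phi t - F y = T y.
  near=> y; apply: Rintegral_itvB => //; rewrite bnd_simp; apply: ltW.
  by near: y; exact: lt_nbhsr.
have dT : is_derive x 1 T (- phi x).
  apply: near_eq_is_derive nT _.
  by rewrite -[X in is_derive _ _ _ X]add0r; exact: is_deriveB.
have : is_derive x 1 (expR * T) (expR x *: - phi x + T x *: expR x) by exact: is_deriveM.
have -> : expR x *: - phi x + T x *: expR x = stein_mean x - h x.
  rewrite /stein_mean -/(T x) /phi /GRing.scale/=.
  have := expRxMexpNx_1 x; set a := expR x; set b := expR (- x) => ab.
  rewrite (_ : a * - (h x * b) = - (h x * (a * b))); last by ring.
  by rewrite ab; ring.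
by [].
Unshelve. all: by end_near. Qed.

(** This is [E |h(x + Y) - h(x)| <= M E(Y) = M], written with integrals over []x, +oo[]. *)
Lemma stein_mean_dist x : -1 < x -> `|stein_mean x - h x| <= M.
Proof.
move=> x1; have ix := integrable_phi_itv (ltW x1).
have sub : `]x, +oo[ `<=` `[x, +oo[.
  by move=> t /=; rewrite !in_itv/= !andbT => /ltW.
pose l c t := (t - c) * expR (- t).
have ilin c : c <= x -> mu.-integrable `]x, +oo[ (EFin \o l c).
  by move=> cx; apply: integrableS (integrable_linear_expRN cx).
have iexp : mu.-integrable `]x, +oo[ (EFin \o (fun t => expR (- t))).
  rewrite (_ : EFin \o _ = ((EFin \o l (x - 1)%R) \- (EFin \o l x))%E).
    by apply: integrableB => //; apply: ilin; lra.
  by apply/funext => t /=; rewrite -EFinB /l; congr (_%:E); ring.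
have Rexp : \int[mu]_(t in `]x, +oo[) expR (- t) = expR (- x).
  transitivity (\int[mu]_(t in `]x, +oo[) (l (x - 1) t - l x t)).
    by apply: eq_Rintegral => t _; rewrite /l; ring.
  rewrite RintegralB//; [|by apply: ilin; lra|by apply: ilin; lra].
  by rewrite !Rintegral_linear_expRN; lra.
pose q t := (h t - h x) * expR (- t).
have iq : mu.-integrable `]x, +oo[ (EFin \o q).
  rewrite (_ : EFin \o q = ((EFin \o phi) \-
    (fun t => (h x)%:E * (expR (- t)%R)%:E))%E).
    by apply: integrableB => //; exact: integrableZl.
  by apply/funext => t /=; rewrite /q /phi mulrBl.
have -> : stein_mean x - h x = expR x * \int[mu]_(t in `]x, +oo[) q t.
  have -> : \int[mu]_(t in `]x, +oo[) q t =
      \int[mu]_(t in `]x, +oo[) (phi t - h x * expR (- t)).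
    by apply: eq_Rintegral => t _; rewrite /q /phi mulrBl.
  rewrite RintegralB//; last exact: (integrableZl _ (h x) iexp).
  rewrite RintegralZl// Rexp mulrBr /stein_mean; congr (_ - _).
  by rewrite mulrCA expRxMexpNx_1 mulr1.
rewrite normrM ger0_norm ?expR_ge0// mulrC -ler_pdivlMr ?expR_gt0// -expRN.
apply: le_trans (le_normr_Rintegral _ iq) _ => //.
have -> : M * expR (- x) =
    \int[mu]_(t in `]x, +oo[) (M * ((t - x) * expR (- t))).
  by rewrite RintegralZl ?Rintegral_linear_expRN ?subrr ?add0r ?mul1r//; exact: ilin.
apply: le_Rintegral => //.
- exact: integrable_norm iq.
- exact: (integrableZl _ M (ilin _ (lexx x))).
- move=> t /=; rewrite in_itv/= andbT => xt.
  rewrite /q normrM (ger0_norm (expR_ge0 _)) mulrA ler_wpM2r ?expR_ge0//.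
  exact/h_lip/ltW.
Qed.

Lemma stein_mean_continuous x : -1 < x -> {for x, continuous stein_mean}.
Proof.
by move=> /is_derive_stein_mean[/derivable1_diffP/differentiable_continuous].
Qed.

Lemma stein_mean_MVT u v : 0 <= u -> u <= v -> exists2 c, u <= c <= v &
  stein_mean v - stein_mean u = (stein_mean c - h c) * (v - u).
Proof.
move=> u0 uv.
have [|||c cuv ->] := @MVT_segment R stein_mean (fun c => stein_mean c - h c) u v.
- by [].
- move=> x; rewrite in_itv/= => /andP[ux _]; apply: is_derive_stein_mean; lra.
- apply: continuous_in_subspaceT => x; rewrite inE/= in_itv/= => /andP[ux _].
  by apply: stein_mean_continuous; lra.
- by exists c => //; rewrite in_itv/= in cuv.
Qed.

Lemma stein_mean_lipschitz u v : 0 <= u -> u <= v ->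
  `|stein_mean v - stein_mean u| <= M * (v - u).
Proof.
move=> u0 uv; have [c /andP[uc _] ->] := stein_mean_MVT u0 uv.
rewrite normrM (ger0_norm (_ : 0 <= v - u)) ?subr_ge0//.
by rewrite ler_wpM2r ?subr_ge0// stein_mean_dist//; lra.
Qed.

(** Put [g = h - stein_mean]. The mean value theorem gives a [c] for which the error is [(v - u)/2]
    times [(g v - g c) - (g c - g u)], and [g] is [2M]-Lipschitz. *)
Lemma stein_mean_trapezoid u v : 0 <= u -> u <= v ->
  `|(v - u) / 2 * ((h u - stein_mean u) + (h v - stein_mean v)) +
    (stein_mean v - stein_mean u)| <= M * (v - u) ^+ 2.
Proof.
move=> u0 uv; have [c /andP[uc cv] ->] := stein_mean_MVT u0 uv.
have c0 : 0 <= c by lra.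
have huc := h_lip uc; have hcv := h_lip cv.
have Huc := stein_mean_lipschitz u0 uc; have Hcv := stein_mean_lipschitz c0 cv.
rewrite (_ : _ + _ = (v - u) / 2 *
    ((h v - h c) - (h c - h u) - (stein_mean v - stein_mean c) +
     (stein_mean c - stein_mean u))); last by field.
rewrite normrM ger0_norm; last by rewrite divr_ge0// subr_ge0.
rewrite (_ : M * _ = (v - u) / 2 * (2 * M * (v - u))); last by field.
apply: ler_wpM2l; first by rewrite divr_ge0// subr_ge0.
move: huc hcv Huc Hcv; rewrite !ler_norml; lra.
Qed.

Lemma integral_exponential_stein_mean :
  (\int[exponential_prob (1 : R)]_y (h y)%:E = (stein_mean 0)%:E)%E.
Proof.
rewrite integral_exponential_prob// /stein_mean expR0 mul1r.
rewrite Rintegral_itv_obnd_cbnd; last by apply: integrable_phi_itv; lra.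
rewrite /Rintegral fineK//; apply: integrable_fin_num => //.
apply: integrableS integrable_phi => //.
by move=> t /=; rewrite !in_itv/= !andbT; lra.
Qed.

End stein_equation.

(** * The law of the eigenvalues *)

Definition bl_tail {R : realType} (n k : nat) : R :=
  'C(2 * n, n + k)%:R / 'C(2 * n, n)%:R.

Section discrete.
Context {R : realType} (n : nat).
Hypothesis n_gt0 : (0 < n)%N.
Local Notation T := (@bl_tail R n).

Let binn_neq0 : 'C(2 * n, n)%:R != 0 :> R.
Proof. by rewrite pnatr_eq0 -lt0n bin_gt0 leq_pmull. Qed.

Lemma bl_tail_ge0 k : 0 <= T k.
Proof. by rewrite /bl_tail divr_ge0. Qed.

Lemma bl_tail0 : T 0 = 1.
Proof. by rewrite /bl_tail addn0 divff. Qed.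

Lemma bl_tail_out : T n.+1 = 0.
Proof. by rewrite /bl_tail bin_small ?mul0r// mul2n -addnn addnS. Qed.

(** Both sides differ by [(n - k) T_k - (n + k + 1) T_(k+1)], which vanishes by the ratio of
    consecutive binomials. *)
Lemma bl_tail_rec k : (k <= n)%N ->
  n%:R * (T k - T k.+1) = k%:R * T k + k.+1%:R * T k.+1.
Proof.
move=> kn; rewrite /bl_tail addnS.
have /(congr1 (fun m => m%:R : R)) := mul_bin_left (2 * n) (n + k).
have -> : (2 * n - (n + k) = n - k)%N by rewrite mul2n -addnn subnDl.
rewrite !natrM natrB// -[(n + k).+1]addn1 -[k.+1]addn1 !natrD => e.
rewrite -mulrBl !mulrA -mulrDl; congr (_ / _); lra.
Qed.

Lemma bl_piE k : (k <= n)%N -> bl_pi n (n - k) = T k - T k.+1.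
Proof.
move=> kn; rewrite /bl_pi /bl_tail -mulrBl; congr ((_ - _) / _).
  rewrite mul2n -addnn -(@bin_sub (n + n) (n + k)) ?leq_add2l//.
  by rewrite subnDl.
(* For [k = n] the index is [0]: the convention for the missing binomial matches [T_(n+1) = 0]. *)
move: kn; rewrite leq_eqVlt => /predU1P[->|kn].
  by rewrite subnn bin_small// addnS mul2n -addnn.
rewrite -(@prednK (n - k)) ?subn_gt0//.
rewrite mul2n -addnn -(@bin_sub (n + n) (n + k.+1)) ?leq_add2l//.
by rewrite subnDl subnS.
Qed.

Lemma bl_lambdaE k : (k <= n)%N ->
  n%:R * bl_lambda n (n - k) + 1 = k%:R * k.+1%:R / n%:R :> R.
Proof.
move=> kn; rewrite /bl_lambda natrB// -natr1.
have n0 : n%:R != 0 :> R by rewrite pnatr_eq0 -lt0n.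
by field.
Qed.

Lemma bl_sumE (h : R -> R) :
  \sum_(i < n.+1) bl_pi n i * h (n%:R * bl_lambda n i + 1) =
  \sum_(k < n.+1) (T k - T k.+1) * h (k%:R * k.+1%:R / n%:R).
Proof.
rewrite (reindex_inj rev_ord_inj)/=; apply: eq_bigr => k _.
have kn : (k <= n)%N by rewrite -ltnS ltn_ord.
by rewrite subSS bl_piE// bl_lambdaE.
Qed.

(** Apply the recurrence, then shift the index in the terms [k T_k a_k]; the boundary terms vanish
    by the factor [0] and by [T_(n+1) = 0]. *)
Lemma bl_mean_stein (a : nat -> R) :
  n%:R * \sum_(k < n.+1) (T k - T k.+1) * a k =
  \sum_(k < n.+1) k.+1%:R * T k.+1 * (a k.+1 + a k).
Proof.
rewrite mulr_sumr.
transitivity (\sum_(k < n.+1) (k%:R * T k * a k + k.+1%:R * T k.+1 * a k)).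
  apply: eq_bigr => k _; rewrite mulrA bl_tail_rec ?mulrDl//.
  by rewrite -ltnS ltn_ord.
under [RHS]eq_bigr do rewrite mulrDr.
rewrite !big_split/=; congr (_ + _).
rewrite big_ord_recl/= !mul0r add0r [RHS]big_ord_recr/= bl_tail_out.
by rewrite mulr0 mul0r addr0.
Qed.

Lemma bl_mean_abel (a : nat -> R) :
  \sum_(k < n.+1) (T k - T k.+1) * a k =
  a 0%N + \sum_(k < n.+1) T k.+1 * (a k.+1 - a k).
Proof.
under eq_bigr do rewrite mulrBl.
under [in RHS]eq_bigr do rewrite mulrBr.
rewrite !sumrB addrA; congr (_ - _).
rewrite big_ord_recl/= bl_tail0 mul1r; congr (_ + _).
by rewrite [RHS]big_ord_recr/= bl_tail_out mul0r addr0.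
Qed.

(** Take [a = 1] in both summation identities. *)
Lemma bl_tail_moment1 : \sum_(k < n.+1) k.+1%:R * T k.+1 = n%:R / 2.
Proof.
have := bl_mean_stein (fun=> 1); have := bl_mean_abel (fun=> 1).
rewrite [X in _ = _ + X]big1 => [->|k _]; last by rewrite subrr mulr0.
by rewrite -mulr_suml; lra.
Qed.

(** Take [a_k = k (k + 1)]: its increments are [2 (k + 1)], which the first moment handles, and
    [a_(k+1) + a_k = 2 (k + 1)^2]. *)
Lemma bl_tail_moment3 :
  \sum_(k < n.+1) k.+1%:R ^+ 3 * T k.+1 = n%:R ^+ 2 / 2.
Proof.
have := bl_mean_stein (fun k => k%:R * k.+1%:R).
rewrite (bl_mean_abel (fun k => k%:R * k.+1%:R)) mul0r add0r.
under eq_bigr.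
  move=> k _.
  rewrite (_ : _ * _ = (k.+1%:R * T k.+1) * 2); last by rewrite -!natr1; ring.
  over.
under [RHS]eq_bigr.
  move=> k _.
  rewrite (_ : _ * _ = (k.+1%:R ^+ 3 * T k.+1) * 2); last by rewrite -!natr1; ring.
  over.
rewrite -!mulr_suml bl_tail_moment1; lra.
Qed.

(* AM-GM [2 k^2 <= sqrt n k + k^3 / sqrt n] reduces to the two moments above. *)
Lemma bl_tail_moment2 :
  \sum_(k < n.+1) k.+1%:R ^+ 2 * T k.+1 <= n%:R ^+ 2 / (2 * Num.sqrt n%:R).
Proof.
set r := Num.sqrt n%:R.
have r0 : 0 < r by rewrite sqrtr_gt0 ltr0n.
have rr : n%:R = r ^+ 2 by rewrite sqr_sqrtr.
apply: (@le_trans _ _ (\sum_(k < n.+1)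
   ((r / 2) * (k.+1%:R * T k.+1) + (k.+1%:R ^+ 3 * T k.+1) / (2 * r)))).
  apply: ler_sum => k _; set x : R := k.+1%:R.
  have x0 : 0 <= x by rewrite ler0n.
  rewrite (_ : (r / 2) * (x * T k.+1) + (x ^+ 3 * T k.+1) / (2 * r) =
    x ^+ 2 * T k.+1 + (r - x) ^+ 2 * x * T k.+1 / (2 * r)).
    have xT : 0 <= (r - x) ^+ 2 * x * T k.+1.
      exact: mulr_ge0 (mulr_ge0 (sqr_ge0 _) x0) (bl_tail_ge0 _).
    by rewrite lerDl divr_ge0// mulr_ge0// ltW.
  by field; rewrite gt_eqF.
rewrite big_split/= -mulr_sumr -mulr_suml bl_tail_moment1 bl_tail_moment3 rr.
by rewrite le_eqVlt; apply/orP; left; apply/eqP; field; rewrite gt_eqF.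
Qed.

(** The Stein identity for [g] and Abel summation for [f] produce the same weights [T_(k+1)], since
    [(k + 1) / n] is half of the step [w_(k+1) - w_k]. *)
Lemma stein_trapezoid (f g : R -> R) (M : R) : 
  0 <= M -> f 0 = 0 ->
  (forall u v, 0 <= u -> u <= v ->
    `|(v - u) / 2 * (g u + g v) - (f v - f u)| <= M * (v - u) ^+ 2) ->
  `|\sum_(k < n.+1) (T k - T k.+1) *
     (g (k%:R * k.+1%:R / n%:R) - f (k%:R * k.+1%:R / n%:R))|
  <= 2 * M / Num.sqrt n%:R.
Proof.
move=> M0 f0 fg; pose w k : R := k%:R * k.+1%:R / n%:R.
have n0 : 0 < n%:R :> R by rewrite ltr0n.
have wd k : w k.+1 - w k = 2 * k.+1%:R / n%:R.
  by rewrite /w -!natr1; field; rewrite gt_eqF.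
under eq_bigr do rewrite mulrBr.
rewrite sumrB (bl_mean_abel (fun k => f (w k))).
rewrite {1}/w mul0r mul0r f0 add0r.
have -> : \sum_(k < n.+1) (T k - T k.+1) * g (k%:R * k.+1%:R / n%:R) =
    \sum_(k < n.+1) T k.+1 * ((w k.+1 - w k) / 2 * (g (w k) + g (w k.+1))).
  have nz : n%:R != 0 :> R by rewrite gt_eqF.
  apply: (mulfI nz); rewrite (bl_mean_stein (fun k => g (w k))) mulr_sumr.
  by apply: eq_bigr => k _; rewrite wd; field.
rewrite -sumrB (le_trans (ler_norm_sum _ _ _))//.
(* The squared step is [4 (k + 1)^2 / n^2], which leaves the second moment. *)
apply: (@le_trans _ _ (\sum_(k < n.+1)
    (4 * M / n%:R ^+ 2) * (k.+1%:R ^+ 2 * T k.+1))).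
  apply: ler_sum => k _; rewrite -mulrBr normrM ger0_norm ?bl_tail_ge0//.
  have wk : w k <= w k.+1 by rewrite -subr_ge0 wd !mulr_ge0 ?invr_ge0.
  have w0 : 0 <= w k by rewrite /w !mulr_ge0 ?invr_ge0.
  rewrite (le_trans (ler_wpM2l (bl_tail_ge0 _) (fg _ _ w0 wk)))// wd.
  by rewrite le_eqVlt; apply/orP; left; apply/eqP; field; rewrite gt_eqF.
rewrite -mulr_sumr.
have c0 : 0 <= 4 * M / n%:R ^+ 2 by rewrite !mulr_ge0// invr_ge0 exprn_ge0// ltW.
rewrite (le_trans (ler_wpM2l c0 bl_tail_moment2))//.
have r0 : 0 < Num.sqrt n%:R :> R by rewrite sqrtr_gt0.
by rewrite le_eqVlt; apply/orP; left; apply/eqP; field; rewrite !gt_eqF.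
Qed.

End discrete.

Unset Implicit Arguments.

(* E h(W) = sum_{i=0}^n pi_i h(n lambda_i + 1);
   E h(Y) = integral of h against the exponential law of rate (= mean) 1.
   M is any bound on |h'| at every point where h is differentiable
   (so M can be taken to be ||h'|| = sup_x |h'(x)|). *)
Theorem theorem3p2 (R : realType) (n : nat) (h : R -> R) (M : R) :
  (1 <= n)%N ->
  abs_continuous_fun h ->
  (forall x : R, derivable h x 1 -> `|(h^`())%classic x| <= M) ->
  (`| (\sum_(i < n.+1) bl_pi n i * h (n%:R * bl_lambda n i + 1))%:E
      - \int[exponential_prob (1 : R)]_y (h y)%:E |
   <= (12 * M / Num.sqrt n%:R)%:E)%E.
Proof.
move=> n1 hac hM.
have M0 := abs_continuous_fun_bound_ge0 hac hM.
have lip := abs_continuous_fun_lipschitz hac M0 hM.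
rewrite (integral_exponential_stein_mean M0 lip) -EFinB lee_fin bl_sumE//.
pose H := stein_mean h; rewrite -/H.
have -> : \sum_(k < n.+1) (bl_tail n k - bl_tail n k.+1) *
      h (k%:R * k.+1%:R / n%:R) - H 0 =
    \sum_(k < n.+1) (bl_tail n k - bl_tail n k.+1) *
      ((h (k%:R * k.+1%:R / n%:R) - H (k%:R * k.+1%:R / n%:R)) -
       (H 0 - H (k%:R * k.+1%:R / n%:R))).
  (* The weights sum to [1], so [H 0] can be moved inside the sum. *)
  have e := bl_mean_abel n (fun=> H 0).
  rewrite [X in _ = _ + X]big1 ?addr0 in e; last by move=> k _; rewrite subrr mulr0.
  rewrite -{1}e -sumrB; apply: eq_bigr => k _; ring.
have trap u v : 0 <= u -> u <= v ->
    `|(v - u) / 2 * ((h u - H u) + (h v - H v)) - ((H 0 - H v) - (H 0 - H u))|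
    <= M * (v - u) ^+ 2.
  move=> u0 uv; have := stein_mean_trapezoid M0 lip u0 uv; rewrite -/H.
  by rewrite (_ : H v - H u = - ((H 0 - H v) - (H 0 - H u))); last by ring.
apply: le_trans (stein_trapezoid n1 (f := fun x => H 0 - H x)
  (g := fun x => h x - H x) M0 (subrr _) trap) _.
(* The constant obtained is [2], which is at most [12]. *)
by rewrite ler_wpM2r ?invr_ge0 ?sqrtr_ge0// ler_wpM2r// ler_nat.
Qed.
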